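(* Let $(V(t))_{t\ge0}$ be a continuous motion of point cloud $d$-varifolds in $\mathbb{R}^n$ by approximate mean curvature with $\Pi=2\,\mathrm{Id}$. Then for every $a\in\mathbb{R}^n$ and $R>0$, $$\operatorname{spt}\|V(0)\|\subset B(a,R)^c\ \Longrightarrow\ \operatorname{spt}\|V(t)\|\subset B\big(a,\sqrt{R^2-2dt}\,\big)^c\quad\text{for all }t\in[0,R^2/2d].$$
   Context: Here $B(a,r)$ is the open ball of center $a$ and radius $r$ in $\mathbb{R}^n$ and $B(a,r)^c$ its complement. The functions $\rho,\xi:\mathbb{R}^+\to\mathbb{R}$ are non-negative, smooth, supported in $[0,1]$, and form a natural kernel pair: $-s\rho'(s)=n\,\xi(s)$ for all $s\in\mathbb{R}^+$. Fix $\varepsilon\in(0,1)$. A point cloud $d$-varifold is $V=\sum_{i=1}^N m_i\delta_{(x_i,P_i)}$ with $x_i\in\mathbb{R}^n$, masses $m_i>0$ and $d$-planes $P_i$; $\operatorname{spt}\|V\|=\{x_1,\dots,x_N\}$. A continuous motion by approximate mean curvature with $\Pi=2\,\mathrm{Id}$ is a family $V(t)=\sum_{i=1}^N m_i(t)\delta_{(x_i(t),P_i(t))}$ such that $$\frac{d}{dt}x_i(t)=\frac1\varepsilon\sum_{j=1}^N\omega_{ij}(t)\,2\,(x_j(t)-x_i(t)),\qquad i=1,\dots,N,$$ where $\omega_{ii}=0$ and, for $i\ne j$, $$\omega_{ij}(t)=-\frac dn\,\frac{m_j(t)\,\rho'\!\left(\frac{|x_j(t)-x_i(t)|}{\varepsilon}\right)\frac1{|x_j(t)-x_i(t)|}}{\sum_{l=1}^N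 m_l(t)\,\xi\!\left(\frac{|x_l(t)-x_i(t)|}{\varepsilon}\right)}$$ (the denominators being assumed positive along the motion, and the term with index $j$ being understood as $0$ if $x_j(t)=x_i(t)$). The rules defining the masses $m_i(t)>0$ and the planes $P_i(t)$ along the motion are arbitrary. If the motion exists only on a time interval, the statement concerns times $t$ in that interval. *)

(* Defs.v *)
From HB Require Import structures.
From mathcomp Require Import all_boot all_order all_algebra.
From mathcomp Require Import all_classical all_reals all_analysis.
Set Implicit Arguments.
Unset Strict Implicit.
Unset Printing Implicit Defensive.
Import Order.TTheory GRing.Theory Num.Theory.
Import numFieldNormedType.Exports.
Local Open Scope classical_set_scope.
Local Open Scope ring_scope.

(* The library norm on 'rV[R]_n is the sup norm, whence the Euclidean norm and
   balls below; the topology is the same. *)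
Definition enorm (R : realType) (n : nat) (u : 'rV[R]_n) : R :=
  Num.sqrt (\sum_(k < n) u 0 k ^+ 2).

Definition eball (R : realType) (n : nat) (a : 'rV[R]_n) (r : R) : set 'rV[R]_n :=
  [set x | enorm (x - a) < r].

(* Derivatives relative to a set A: only increments h != 0 with t + h \in A are
   used, so they are one-sided at the endpoints of an interval. *)
Definition slope_within (R : realType) (V : normedModType R) (A : set R)
    (f : R -> V) (t : R) : set_system V :=
  (fun h : R => h^-1 *: (f (t + h) - f t))
    @ within [set h | A (t + h)] (0 : R)^'.

Definition derivable_within (R : realType) (V : normedModType R) (A : set R)
    (f : R -> V) (t : R) : Prop :=
  cvg (slope_within A f t).

Definition derive_within (R : realType) (V : normedModType R) (A : set R)
    (f : R -> V) (t : R) : V :=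
  lim (slope_within A f t).

Definition is_derive_within (R : realType) (V : normedModType R) (A : set R)
    (f : R -> V) (t : R) (v : V) : Prop :=
  slope_within A f t --> v.

Definition smooth_on (R : realType) (A : set R) (f : R -> R) : Prop :=
  forall (k : nat) (s : R), A s ->
    derivable_within A (iter k (@derive_within R R A) f) s.

(* Functions on R^+ are represented by functions on R whose values at negative
   reals are never used. *)
Definition Rplus (R : realType) : set R := [set s | 0 <= s].

Definition natural_kernel_pair (R : realType) (n : nat) (rho xi : R -> R) : Prop :=
  [/\ forall s, 0 <= s -> 0 <= rho s /\ 0 <= xi s,
      smooth_on (@Rplus R) rho /\ smooth_on (@Rplus R) xi,
      forall s, 1 < s -> rho s = 0 /\ xi s = 0 &
      forall s, 0 <= s -> - s * derive_within (@Rplus R) rho s = n%:R * xi s].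

Definition grassmannian (R : realType) (n d : nat) : Type :=
  {P : {vspace 'rV[R]_n} | \dim P == d}.

Record pcvarifold (R : realType) (n d N : nat) : Type := PCVarifold {
  pos : 'I_N -> 'rV[R]_n;
  mass : 'I_N -> R;
  plane : 'I_N -> grassmannian R n d;
  mass_gt0 : forall i, 0 < mass i }.

(* The measure \sum_i m_i \delta_(x_i, P_i) on R^n x G(d, n); being a finite sum
   of Dirac masses it is defined on every set. *)
Definition varifold_measure (R : realType) (n d N : nat) (V : pcvarifold R n d N)
    (A : set ('rV[R]_n * grassmannian R n d)) : R :=
  \sum_(i < N) mass V i * \1_A (pos V i, plane V i).

(* The weight ||V||, i.e. the push-forward of V to R^n. *)
Definition weight (R : realType) (n d N : nat) (V : pcvarifold R n d N)
    (B : set 'rV[R]_n) : R :=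
  varifold_measure V (fst @^-1` B).

Definition spt (R : realType) (n d N : nat) (V : pcvarifold R n d N)
    : set 'rV[R]_n :=
  [set x | forall U : set 'rV[R]_n, nbhs x U -> 0 < weight V U].

Lemma sptE (R : realType) (n d N : nat) (V : pcvarifold R n d N) :
  spt V = range (pos V).
Proof.
have ge0 (U : set 'rV[R]_n) i :
    0 <= mass V i * \1_(fst @^-1` U : set ('rV[R]_n * grassmannian R n d))
                       (pos V i, plane V i).
  by rewrite mulr_ge0 ?(ltW (mass_gt0 _ _)) // indicE ler0n.
apply/seteqP; split=> [x sx | _ [i _ <-] U Ux]; last first.
  rewrite /weight /varifold_measure (bigD1 i) //= ltr_pwDl ?sumr_ge0 //.
  rewrite indicE mem_set ?mulr1 ?mass_gt0 //=; exact: nbhs_singleton.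
apply: contrapT => nx.
have U_x : nbhs x (~` range (pos V)).
  apply: open_nbhs_nbhs; split=> //; apply: closed_openC.
  move: (range (pos V)) (finite_image (pos V) (@finite_finset _ setT)).
  apply/accessible_finite_set_closed/hausdorff_accessible.
  exact: norm_hausdorff.
have := sx _ U_x; rewrite /weight /varifold_measure big1 ?ltxx // => i _.
rewrite indicE memNset ?mulr0 //= => /(_ _); apply; by exists i.
Qed.

Definition omega_den (R : realType) (n d N : nat) (eps : R) (xi : R -> R)
    (V : pcvarifold R n d N) (i : 'I_N) : R :=
  \sum_(l < N) mass V l * xi (enorm (pos V l - pos V i) / eps).

Definition omega (R : realType) (n d N : nat) (eps : R) (rho xi : R -> R)
    (V : pcvarifold R n d N) (i j : 'I_N) : R :=
  if pos V j == pos V i then 0 else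
  - (d%:R / n%:R) *
    (mass V j * derive_within (@Rplus R) rho (enorm (pos V j - pos V i) / eps)
       * (enorm (pos V j - pos V i))^-1
     / omega_den eps xi V i).

(* Motion by approximate mean curvature with \Pi = 2 Id, on the times t \in J. *)
Definition approx_mean_curvature_motion (R : realType) (n d N : nat) (eps : R)
    (rho xi : R -> R) (J : set R) (V : R -> pcvarifold R n d N) : Prop :=
  forall t, J t -> forall i : 'I_N,
    0 < omega_den eps xi (V t) i /\
    is_derive_within J (fun s => pos (V s) i : 'rV[R]_n) t
      (eps^-1 *: \sum_(j < N)
         omega eps rho xi (V t) i j *: (2 *: (pos (V t) j - pos (V t) i))).

(* Main.v *)
Require Import Defs.
From mathcomp Require Import all_boot all_order all_algebra.
From mathcomp Require Import all_classical all_reals all_analysis.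
From mathcomp Require Import ring lra.
Import Order.TTheory GRing.Theory Num.Theory.
Import numFieldNormedType.Exports.
Local Open Scope classical_set_scope.
Local Open Scope ring_scope.

(** This is a comparison argument with the sphere of radius
    sqrt (r ^ 2 - 2 d t), carried by the squared distances
    u_i = |x_i - a| ^ 2.  Polarizing 2 <x_j - x_i, x_i - a> in the equation of
    motion gives
      u_i' = (2 / eps) * sum_j omega_ij * (u_j - u_i - |x_j - x_i| ^ 2)
    ([dot_velocity]).  The kernel identity -s rho'(s) = n xi(s) enters twice.
    It makes omega_ij nonnegative ([omega_ge0]), so at an index where u_i is
    the smallest the terms u_j - u_i can only push x_i away from a.  It also
    turns omega_ij |x_j - x_i| ^ 2 into eps * d times the share of the j-th
    particle in the denominator of omega_ij ([omega_enorm_sqr]); the shares add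
    up to 1, so the remaining sum is at most eps * d
    ([sum_omega_enorm_sqr_le]).  Hence u_i' >= - 2 d whenever x_i is closest to
    a ([velocity_at_closest_point]).

    That a lower bound on the derivative of the currently smallest function
    bounds the whole family from below is [minimum_principle].  The
    minimum over i of the u_i need not be differentiable; this is avoided by
    minimizing each function over the time interval and comparing the finitely
    many minima. *)

(** * Euclidean geometry *)

Lemma enorm_sqr (R : realType) (n : nat) (u : 'rV[R]_n) :
  enorm u ^+ 2 = \sum_(k < n) u 0 k ^+ 2.
Proof. by rewrite sqr_sqrtr // sumr_ge0 // => k _; exact: sqr_ge0. Qed.

Lemma enorm_ge0 (R : realType) (n : nat) (u : 'rV[R]_n) : 0 <= enorm u.
Proof. exact: sqrtr_ge0. Qed.

Lemma enorm_eq0 (R : realType) (n : nat) (u : 'rV[R]_n) :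
  (enorm u == 0) = (u == 0).
Proof.
apply/eqP/eqP => [u0|->]; last first.
  by rewrite /enorm big1 ?sqrtr0 // => k _; rewrite mxE expr0n.
have /eqP := enorm_sqr R n u.
rewrite u0 expr0n /= eq_sym psumr_eq0; last by move=> k _; exact: sqr_ge0.
move=> /allP uk; apply/rowP => k; rewrite mxE; apply/eqP.
by rewrite -sqrf_eq0; apply: uk; rewrite mem_index_enum.
Qed.

Lemma polarization (R : realType) (n : nat) (a x y : 'rV[R]_n) :
  2 * (\sum_(k < n) (y - x) 0 k * (x - a) 0 k) =
  enorm (y - a) ^+ 2 - enorm (x - a) ^+ 2 - enorm (y - x) ^+ 2.
Proof.
rewrite !enorm_sqr -!sumrB mulr_sumr; apply: eq_bigr => k _.
by rewrite !mxE; ring.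
Qed.

(** * Derivatives within a set *)

Lemma near_within_neq0 {R : realType} (B : set R) :
  \forall h \near within B (0 : R)^', h != 0.
Proof. exact: cvg_within (nbhs_dnbhs_neq (0 : R)). Qed.

(** Continuity of [f] written with increments, the form in which it enters the
    product rule: f (t + h) is f t plus h times the slope. *)
Lemma is_derive_within_shift {R : realType} {A : set R} {f : R -> R} {t v : R} :
  is_derive_within A f t v ->
  f (t + h) @[h --> within [set h | A (t + h)] (0 : R)^'] --> f t.
Proof.
move=> fv.
have h0 : h @[h --> within [set h | A (t + h)] (0 : R)^'] --> (0 : R).
  by apply: cvg_within_filter; apply: cvg_within.
have : f t + h * (h^-1 *: (f (t + h) - f t))
    @[h --> within [set h | A (t + h)] (0 : R)^'] --> f t + 0 * v.
  by apply: cvgD; [exact: cvg_cst|exact: cvgM].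
rewrite mul0r addr0; apply: cvg_trans; apply: near_eq_cvg.
apply: filterS (near_within_neq0 _) => h h_neq0 /=.
by rewrite -[_ *: _]/(_ * _) mulVKf // addrC subrK.
Qed.

Lemma is_derive_within_continuous {R : realType} {A : set R} {f : R -> R}
    {t v : R} :
  is_derive_within A f t v -> f @ within A (nbhs t) --> f t.
Proof.
move=> /is_derive_within_shift ft P Pft; have := ft P Pft.
rewrite !nbhs_simpl /= => P0.
have {P0} P0 : \forall h \near (0 : R), h != 0 -> A (t + h) -> P (f (t + h)).
  exact: P0.
change (\forall s \near t, A s -> P (f s)).
rewrite (near_shift 0) subr0; apply: filterS P0 => h P0 /=.
have [->|h0] := eqVneq h 0; first by rewrite add0r => _; exact: nbhs_singleton.
by rewrite addrC; exact: P0.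
Qed.

(** The slopes to the left of a left-sided local minimum are nonpositive, and
    their sign passes to the limit. *)
Lemma is_derive_within_left_min {R : realType} {A : set R} {f : R -> R}
    {t v e : R} :
  0 < e -> (forall s, t - e <= s <= t -> A s /\ f t <= f s) ->
  is_derive_within A f t v -> v <= 0.
Proof.
move=> e0 Hs fv; rewrite leNgt; apply/negP => v0.
have : \forall h \near (0 : R), h != 0 -> A (t + h) ->
    0 < h^-1 *: (f (t + h) - f t) by exact: cvgr_gt v fv 0 v0.
move=> /nbhs_ballP[b /= b0 bP].
pose h := - (Num.min (b / 2) e).
have m0 : 0 < Num.min (b / 2) e by rewrite lt_min e0 divr_gt0.
have mb : Num.min (b / 2) e <= b / 2 by rewrite ge_min lexx.
have me : Num.min (b / 2) e <= e by rewrite ge_min lexx orbT.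
have [|Ah fh] := Hs (t + h); first by rewrite /h; lra.
have /= : 0 < h^-1 *: (f (t + h) - f t).
  apply: bP => //.
    by rewrite /ball /= sub0r normrN /h normrN gtr0_norm //; lra.
  by rewrite /h oppr_eq0 gt_eqF.
rewrite ltNge -[_ *: _]/(_ * _) mulr_le0_ge0 // ?subr_ge0 // invr_le0 /h; lra.
Qed.

Lemma is_derive_within_add_linear {R : realType} {A : set R} {f : R -> R}
    {t v : R} (b : R) :
  is_derive_within A f t v ->
  is_derive_within A (fun s => f s + b * s) t (v + b).
Proof.
move=> fv.
have : h^-1 *: (f (t + h) - f t) + b
    @[h --> within [set h | A (t + h)] (0 : R)^'] --> v + b.
  by apply: cvgD; [exact: fv|exact: cvg_cst].
apply: cvg_trans.
apply: near_eq_cvg; apply: filterS (near_within_neq0 _) => h h0 /=.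
by rewrite -![_ *: _]/(_ * _); field.
Qed.

(** Adding (b + k) s with a small k > 0 to each w_i makes the derivative of the
    smallest function strictly positive.  Take a pair (i, s) minimizing these
    functions over all indices and all s in [0, T]: if s > 0, then w_i is
    smallest at time s, but its perturbation has a nonpositive derivative
    there, as seen from the left.  So s = 0, where w_i is at least c. *)
Lemma minimum_principle {R : realType} {N : nat} {J : set R}
    (w dw : 'I_N -> R -> R) (b c : R) :
  is_interval J -> J 0 ->
  (forall t i, J t -> is_derive_within J (w i) t (dw i t)) ->
  (forall t i, J t -> (forall j, w i t <= w j t) -> - b <= dw i t) ->
  (forall i, c <= w i 0) ->
  forall t i, J t -> 0 <= t -> c - b * t <= w i t.
Proof.
move=> J_itv J0 w_der w_min w0 T i0 JT T0.
apply/ler_addgt0Pr => e e0.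
(* The perturbation k * s is at most e on [0, T]; the summand 1 is for T = 0. *)
pose k := e / (1 + T).
have T1 : 0 < 1 + T by lra.
have k0 : 0 < k by rewrite divr_gt0.
have kT : k * T <= e.
  by rewrite /k -mulrA ler_piMr ?(ltW e0) // mulrC ler_pdivrMr //; lra.
pose g i s := w i s + (b + k) * s.
have g_der s i : J s -> is_derive_within J (g i) s (dw i s + (b + k)).
  by move=> Js; exact/is_derive_within_add_linear/w_der.
have JE s : 0 <= s <= T -> J s by move=> sT; apply: (J_itv 0 T).
have : forall i, exists s,
    (0 <= s <= T) /\ forall s', 0 <= s' <= T -> g i s <= g i s'.
  move=> i; have [|s] := @EVT_min R (g i) 0 T T0.
    apply/subspace_continuousP => s /=; rewrite in_itv /= => sT.
    have := is_derive_within_continuous (g_der s i (JE s sT)).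
    apply: cvg_trans; apply: cvg_app; apply: within_subset => s' /=.
    by rewrite in_itv /=; exact: JE.
  rewrite in_itv /= => sT gs; exists s; split => // s' s'T; exact: gs.
move=> /choice[tau tauP].
have [i _ imin] := @arg_minP _ _ _ i0 xpredT (fun i => g i (tau i)) isT.
have gi j s : 0 <= s <= T -> g i (tau i) <= g j s.
  by move=> sT; apply: le_trans (imin j isT) _; exact: (tauP j).2.
have [/andP[tau0 tauT] _] := tauP i.
move: tau0; rewrite le_eqVlt => /predU1P[tau0|tau0].
  have := gi i0 T; rewrite -tau0 /g mulr0 addr0 T0 lexx => /(_ isT).
  by have := w0 i; lra.
have Jtau : J (tau i) by apply: JE; rewrite tauT ltW.
have : dw i (tau i) + (b + k) <= 0.
  apply: (is_derive_within_left_min tau0 _ (g_der _ i Jtau)) => s.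
  by rewrite subrr => /andP[s0 st]; split; [apply: JE|apply: gi]; lra.
have : - b <= dw i (tau i).
  apply: w_min => // j; have := gi j (tau i); rewrite tauT ltW //= /g.
  by move=> /(_ isT); lra.
lra.
Qed.

(** Coordinatewise, the increment of a square is the increment times the sum of
    the two values. *)
Lemma is_derive_within_enorm_sqr {R : realType} {n : nat} {A : set R}
    {x : R -> 'rV[R]_n} {t : R} {v : 'rV[R]_n} (a : 'rV[R]_n) :
  is_derive_within A x t v ->
  is_derive_within A (fun s => enorm (x s - a) ^+ 2) t
    (2 * \sum_(k < n) v 0 k * (x t - a) 0 k).
Proof.
move=> xv.
have xk (k : 'I_n) : is_derive_within A (fun s => x s 0 k : R) t (v 0 k).
  have := cvg_comp _ _ xv (@coord_continuous R 1 n 0 k v).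
  apply: cvg_trans; apply: near_eq_cvg; apply: nearW => h /=.
  by rewrite !mxE.
rewrite mulr_sumr.
have -> : \sum_(k < n) 2 * (v 0 k * (x t - a) 0 k) =
          \sum_(k < n) v 0 k * ((x t 0 k - a 0 k) + (x t 0 k - a 0 k)).
  by apply: eq_bigr => k _; rewrite !mxE; ring.
have : \sum_(k < n) ((h^-1 *: (x (t + h) 0 k - x t 0 k)) *
          ((x (t + h) 0 k - a 0 k) + (x t 0 k - a 0 k)))
        @[h --> within [set h | A (t + h)] (0 : R)^'] -->
       \sum_(k < n) v 0 k * ((x t 0 k - a 0 k) + (x t 0 k - a 0 k)).
  apply: cvg_big => [|k _]; first exact: add_continuous.
  apply: cvgM; first exact: xk.
  apply: cvgD (cvg_cst _); apply: cvgB (cvg_cst _).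
  exact: is_derive_within_shift (xk k).
apply: cvg_trans; apply: near_eq_cvg; apply: nearW => h /=.
rewrite !enorm_sqr -sumrB -[_ *: _]/(_ * _) mulr_sumr.
by apply: eq_bigr => k _; rewrite !mxE -[_ *: _]/(_ * _); ring.
Qed.

(** * The motion at a fixed time *)

(** With s = |x_j - x_i| / eps, the product of rho'(s) / |x_j - x_i| and
    |x_j - x_i| ^ 2 is eps s rho'(s), that is - eps n xi(s); the factor d / n
    then cancels n. *)
Lemma omega_enorm_sqr {R : realType} {n d N : nat} {eps : R} {rho xi : R -> R}
    (V : pcvarifold R n d N) (i j : 'I_N) :
  0 < eps -> natural_kernel_pair n rho xi ->
  pos V j != pos V i ->
  omega eps rho xi V i j * enorm (pos V j - pos V i) ^+ 2 =
  eps * d%:R *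
    (mass V j * xi (enorm (pos V j - pos V i) / eps) / omega_den eps xi V i).
Proof.
move=> eps_gt0 [_ _ _ nat_rel] ji; rewrite /omega (negbTE ji).
have e0 : enorm (pos V j - pos V i) != 0 by rewrite enorm_eq0 subr_eq0.
(* Two distinct points exist, so the dimension is positive. *)
have n0 : n%:R != 0 :> R.
  rewrite pnatr_eq0; apply: contraNneq ji => n0; apply/eqP/rowP => -[k k_lt].
  by exfalso; rewrite n0 in k_lt.
move: nat_rel => /(_ (enorm (pos V j - pos V i) / eps)).
set r := enorm _ in e0 *; set D := derive_within _ _ _; set X := xi _.
have r0 : 0 <= r / eps by rewrite divr_ge0 ?enorm_ge0 ?ltW.
move=> /(_ r0) nat_rel.
have {nat_rel} -> : X = - (r / eps) * D / n%:R by rewrite nat_rel mulrC mulKf.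
have eps0 : eps != 0 by rewrite gt_eqF.
move: (omega_den eps xi V i)^-1 => c.
by field; rewrite e0 n0 eps0.
Qed.

Lemma kernel_fraction_ge0 {R : realType} {n d N : nat} {eps : R}
    {rho xi : R -> R} (V : pcvarifold R n d N) (i j : 'I_N) :
  0 < eps -> natural_kernel_pair n rho xi -> 0 < omega_den eps xi V i ->
  0 <= mass V j * xi (enorm (pos V j - pos V i) / eps) / omega_den eps xi V i.
Proof.
move=> eps_gt0 [pos_rho_xi _ _ _] den_gt0.
rewrite divr_ge0 ?(ltW den_gt0) // mulr_ge0 ?(ltW (mass_gt0 _ _)) //.
by apply: (pos_rho_xi _ _).2; rewrite divr_ge0 ?enorm_ge0 ?ltW.
Qed.

(** The sign is read off [omega_enorm_sqr], since |x_j - x_i| ^ 2 > 0. *)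
Lemma omega_ge0 {R : realType} {n d N : nat} {eps : R} {rho xi : R -> R}
    (V : pcvarifold R n d N) (i j : 'I_N) :
  0 < eps -> natural_kernel_pair n rho xi -> 0 < omega_den eps xi V i ->
  0 <= omega eps rho xi V i j.
Proof.
move=> eps_gt0 nkp den_gt0.
have [ji|ji] := eqVneq (pos V j) (pos V i); first by rewrite /omega ji eqxx.
have r0 : 0 < enorm (pos V j - pos V i).
  by rewrite lt_def enorm_ge0 enorm_eq0 subr_eq0 ji.
rewrite -(pmulr_lge0 _ (exprn_gt0 2 r0)) omega_enorm_sqr //.
apply: mulr_ge0; first by rewrite mulr_ge0 ?ler0n ?ltW.
exact: kernel_fraction_ge0 _ _ _ eps_gt0 nkp den_gt0.
Qed.

(** This is where the rate 2 d at which the squared radius shrinks comes from: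
    the shares of all particles in the denominator sum to 1.  A particle
    located at x_i has weight omega_ij = 0 and a nonnegative share. *)
Lemma sum_omega_enorm_sqr_le {R : realType} {n d N : nat} {eps : R}
    {rho xi : R -> R} (V : pcvarifold R n d N) (i : 'I_N) :
  0 < eps -> natural_kernel_pair n rho xi -> 0 < omega_den eps xi V i ->
  \sum_(j < N) omega eps rho xi V i j * enorm (pos V j - pos V i) ^+ 2
    <= eps * d%:R.
Proof.
move=> eps_gt0 nkp den_gt0.
have ed_ge0 : 0 <= eps * d%:R by rewrite mulr_ge0 ?ler0n // ltW.
have sum1 : \sum_(j < N) eps * d%:R *
    (mass V j * xi (enorm (pos V j - pos V i) / eps) / omega_den eps xi V i) =
    eps * d%:R.
  rewrite -mulr_sumr -mulr_suml -/(omega_den eps xi V i).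
  by rewrite divff ?mulr1 // gt_eqF.
rewrite -[leRHS]sum1; apply: ler_sum => j _.
have [ji|ji] := eqVneq (pos V j) (pos V i); last by rewrite omega_enorm_sqr.
have -> : omega eps rho xi V i j = 0 by rewrite /omega ji eqxx.
rewrite mul0r mulr_ge0 //.
exact: kernel_fraction_ge0 _ _ _ eps_gt0 nkp den_gt0.
Qed.

Definition velocity {R : realType} {n d N : nat} (eps : R) (rho xi : R -> R)
    (V : pcvarifold R n d N) (i : 'I_N) : 'rV[R]_n :=
  eps^-1 *: \sum_(j < N)
    omega eps rho xi V i j *: (2 *: (pos V j - pos V i)).

Lemma dot_velocity {R : realType} {n d N : nat} (eps : R) (rho xi : R -> R)
    (V : pcvarifold R n d N) (a : 'rV[R]_n) (i : 'I_N) :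
  2 * (\sum_(k < n) velocity eps rho xi V i 0 k * (pos V i - a) 0 k) =
  2 / eps * \sum_(j < N) omega eps rho xi V i j *
    (enorm (pos V j - a) ^+ 2 - enorm (pos V i - a) ^+ 2
       - enorm (pos V j - pos V i) ^+ 2).
Proof.
under [in RHS]eq_bigr => j _ do rewrite -polarization.
rewrite [LHS]mulr_sumr.
transitivity (\sum_(k < n) \sum_(j < N) 2 / eps * (omega eps rho xi V i j *
    (2 * ((pos V j - pos V i) 0 k * (pos V i - a) 0 k)))).
  apply: eq_bigr => k _.
  rewrite /velocity mxE summxE mulr_sumr mulr_suml mulr_sumr.
  by apply: eq_bigr => j _; rewrite !mxE; ring.
rewrite exchange_big mulr_sumr; apply: eq_bigr => j _ /=.
by rewrite -!mulr_sumr.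
Qed.

(** A particle closest to [a] is attracted only towards particles at least as
    far from [a], which costs at most the second-order terms |x_j - x_i| ^ 2. *)
Lemma velocity_at_closest_point {R : realType} {n d N : nat} {eps : R}
    {rho xi : R -> R} (V : pcvarifold R n d N) (a : 'rV[R]_n) (i : 'I_N) :
  0 < eps -> natural_kernel_pair n rho xi -> 0 < omega_den eps xi V i ->
  (forall j, enorm (pos V i - a) ^+ 2 <= enorm (pos V j - a) ^+ 2) ->
  - (2 * d%:R) <=
  2 * (\sum_(k < n) velocity eps rho xi V i 0 k * (pos V i - a) 0 k).
Proof.
move=> eps_gt0 nkp den_gt0 closest; rewrite dot_velocity.
have -> : - (2 * d%:R) = 2 / eps * (- (eps * d%:R)).
  by field; rewrite gt_eqF.
apply: ler_wpM2l; first by rewrite divr_ge0 ?(ltW eps_gt0).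
apply: (@le_trans _ _ (- \sum_(j < N) omega eps rho xi V i j *
    enorm (pos V j - pos V i) ^+ 2)).
  by rewrite lerN2; exact: sum_omega_enorm_sqr_le.
rewrite -sumrN; apply: ler_sum => j _.
rewrite mulrBr lerDr mulr_ge0 ?omega_ge0 // subr_ge0; exact: closest.
Qed.

(** * Avoidance of the shrinking ball *)

Theorem proposition3p2 (R : realType) (n d N : nat) (d_gt0 : (0 < d)%N)
  (eps : R) (eps_gt0 : 0 < eps) (eps_lt1 : eps < 1)
  (rho xi : R -> R) (rho_xi : natural_kernel_pair n rho xi)
  (J : set R) (J_itv : is_interval J) (J_ge0 : forall t, J t -> 0 <= t) (J0 : J 0)
  (V : R -> pcvarifold R n d N)
  (V_motion : approx_mean_curvature_motion eps rho xi J V)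
  (a : 'rV[R]_n) (r : R) (r_gt0 : 0 < r) :
  spt (V 0) `<=` ~` eball a r ->
  forall t : R, J t -> 0 <= t <= r ^+ 2 / (2 * d%:R) ->
    spt (V t) `<=` ~` eball a (Num.sqrt (r ^+ 2 - 2 * d%:R * t)).
Proof.
rewrite sptE => out0 t Jt /andP[t0 _]; rewrite sptE => _ [i _ <-].
apply/negP; rewrite -leNgt -[leRHS]ger0_norm ?enorm_ge0 // -sqrtr_sqr.
apply: ler_wsqrtr.
apply: (minimum_principle (fun i s => enorm (pos (V s) i - a) ^+ 2)
  (fun i s => 2 * \sum_(k < n)
     velocity eps rho xi (V s) i 0 k * (pos (V s) i - a) 0 k)
  (2 * d%:R) (r ^+ 2) J_itv J0) => // {Jt t0} [s j Js|s j Js closest|j].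
- exact/is_derive_within_enorm_sqr/(V_motion s Js j).2.
- have den_gt0 := (V_motion s Js j).1.
  exact: velocity_at_closest_point _ _ _ eps_gt0 rho_xi den_gt0 closest.
rewrite ler_sqr ?nnegrE ?enorm_ge0 ?(ltW r_gt0) // leNgt; apply/negP.
by apply: out0; exists j.
Qed.
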